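(* Let $G_1, G_2, \dots, G_n$ be compact metric groups, and let $\mu_1, \mu_2, \dots, \mu_n$ be the Haar measures on $G_1, G_2, \dots, G_n$ respectively. Let $h_1$ be a self-homeomorphism of $G_1$ that preserves the Haar measure $\mu_1$, and for each $2 \le j \le n$ let $h_j$ be a map from $G_1 \times \cdots \times G_{j-1}$ to $\operatorname{Homeo}_{\mu_j}(G_j)$. Define $f : G_1 \times \cdots \times G_n \to G_1 \times \cdots \times G_n$ by $$f(x_1, \dots, x_n) = \bigl(h_1(x_1),\, h_2(x_1)(x_2),\, \dots,\, h_n(x_1, \dots, x_{n-1})(x_n)\bigr).$$ If $f$ is a self-homeomorphism of $G_1 \times G_2 \times \cdots \times G_n$, then $f$ preserves the Haar measure $\mu_1 \times \mu_2 \times \cdots \times \mu_n$.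
   Context: For a compact space $X$ and a Borel measure $\mu$ on $X$, $\operatorname{Homeo}_\mu(X)$ denotes the set of all homeomorphisms $X \to X$ that preserve $\mu$, i.e. satisfy $\mu(f^{-1}(B)) = \mu(B)$ for every Borel set $B \subseteq X$. Haar measures are normalized to be probability measures. The maps $h_j$ ($2\le j\le n$) are arbitrary maps (no continuity assumed beyond the hypothesis that $f$ is a homeomorphism). *)

(* Defs.v *)
(* MathComp-Analysis *)
From HB Require Import structures.
From mathcomp Require Import all_boot all_order all_algebra.
From mathcomp Require Import all_classical all_reals all_analysis.

Set Implicit Arguments.
Unset Strict Implicit.
Unset Printing Implicit Defensive.

Local Open Scope classical_set_scope.
Local Open Scope ring_scope.

#[short(type="topMeasurableType")]
HB.structure Definition TopMeasurable d :=
  {T of Topological T & Measurable d T}.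

HB.saturate prod.

(* Compact metric groups carry their Borel sigma-algebra as measurable
   structure. The metric need not be invariant. *)
HB.mixin Record isCompactMetricGroup (R : realType) d T
    of Metric R T & Group T & Measurable d T := {
  mulg_continuous : continuous (fun xy : T * T => (xy.1 * xy.2)%g) ;
  invg_continuous : continuous (fun x : T => (x^-1)%g) ;
  compact_setT : compact [set: T] ;
  measurable_borel : @measurable d T = <<s @open T >>
}.

#[short(type="compactMetricGroupType")]
HB.structure Definition CompactMetricGroup (R : realType) d :=
  {T of Metric R T & Group T & Measurable d T & isCompactMetricGroup R d T}.

(* Left Haar measure; the normalization is in the type of [mu]. *)
Definition is_haar (R : realType) d (G : compactMetricGroupType R d)
    (mu : probability G R) : Prop :=
  forall (g : G) (A : set G), measurable A ->
    mu [set (g * x)%g | x in A] = mu A.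

Definition self_homeomorphism (X : topologicalType) (f : X -> X) : Prop :=
  continuous f /\
  exists g : X -> X, [/\ cancel f g, cancel g f & continuous g].

(* [B] ranges over the Borel sets of the topology of [X], which is not assumed
   to generate the sigma-algebra of the measurable structure. *)
Definition preserves (R : realType) d (X : topMeasurableType d)
    (mu : {measure set X -> \bar R}) (f : X -> X) : Prop :=
  forall B : set X, <<s @open X >> B -> mu (f @^-1` B) = mu B.

Definition Homeo (R : realType) d (X : topMeasurableType d)
    (mu : {measure set X -> \bar R}) : set (X -> X) :=
  [set f | self_homeomorphism f /\ preserves mu f].

Section Products.
Context (R : realType) (d : nat -> measure_display).
Variable G : forall j, compactMetricGroupType R (d j).

Fixpoint gprod_display (n : nat) : measure_display :=
  if n is m.+1 then ((gprod_display m, d m.+1).-prod)%mdisp else d 0%N.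

(* gprod n is the left-nested product (.. (G 0 * G 1) * ..) * G n of the first
   n.+1 groups, with the product topology and the product sigma-algebra. *)
Fixpoint gprod (n : nat) : topMeasurableType (gprod_display n) :=
  match n return topMeasurableType (gprod_display n) with
  | 0%N => G 0%N
  | m.+1 => (gprod m * G m.+1)%type
  end.

Fixpoint gprod_measure (mu : forall j, probability (G j) R) (n : nat) :
    probability (gprod n) R :=
  match n return probability (gprod n) R with
  | 0%N => mu 0%N
  | m.+1 => (gprod_measure mu m \x mu m.+1)%E
  end.

(* (x_0, .., x_n) |-> (h0 x_0, h 0 x_0 x_1, .., h n.-1 (x_0, .., x_n.-1) x_n):
   the fibre maps on G j.+1 are indexed by j. *)
Fixpoint gskew (h0 : G 0%N -> G 0%N)
    (h : forall j, gprod j -> G j.+1 -> G j.+1) (n : nat) :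
    gprod n -> gprod n :=
  match n return gprod n -> gprod n with
  | 0%N => h0
  | m.+1 => fun x => (gskew h0 h x.1, h m x.1 x.2)
  end.

End Products.

(* Main.v *)
Require Import Defs.
From mathcomp Require Import all_boot all_order all_algebra.
From mathcomp Require Import all_classical all_reals all_analysis.

Set Implicit Arguments.
Unset Strict Implicit.
Unset Printing Implicit Defensive.

Local Open Scope classical_set_scope.
Local Open Scope ring_scope.

(** The argument is Fubini plus induction on the number of factors. Write the
    map on the first n+2 factors as a skew product (x, y) |-> (f x, k x y), with
    x in the product of the first n+1 groups. The x-section of the preimage of
    B is the preimage under k x of the section of B over f x, so, k x being
    measure preserving, its measure is that of the section of B over f x.
    Integrating over x, and using that f preserves the measure on the base, gives
    the measure of B: this is [skew_preserves].

    The induction hypothesis needs the base map f to be continuous. This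
    passes from the full map to f, because f x is the first coordinate of the
    image of (x, 1): this is [gskew_continuous_base].

    Preservation is asked of the Borel sets of the product topology, while
    Fubini speaks of the product sigma-algebra. The two agree because compact
    metric spaces are second countable: an open set of a product is then a
    countable union of open rectangles ([is_borel_prod], [gprod_borel]). *)

Lemma second_countable_prod (X Y : topologicalType) :
  @second_countable X -> @second_countable Y -> @second_countable (X * Y)%type.
Proof.
move=> [A cA [oA bA]] [B cB [oB bB]].
exists [set P.1 `*` P.2 | P in A `*` B].
  by apply: sub_countable (card_image_le _ _) _; exact: countableX.
split.
  move=> _ [[U V] [/= /oA oU /oB oV] <-].
  rewrite openE => -[x y] [/= Ux Vy].
  by exists (U, V) => //; split; exact: open_nbhs_nbhs.
move=> [x y] W [[P Q] [/= /bA[U [AU Ux] UP] /bB[V [BV Vy] VQ]] PQW].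
exists (U `*` V).
  by split; [exists (U, V)|].
by move=> [u v] [/UP Pu /VQ Qv]; exact: PQW.
Qed.

Lemma continuous_preimage_borel (X Y : topologicalType) (f : X -> Y)
    (B : set Y) :
  continuous f -> <<s @open Y >> B -> <<s @open X >> (f @^-1` B).
Proof.
move=> /continuousP cf.
suff : <<s @open Y >> `<=` image_set_system setT f <<s @open X >>.
  by move=> /[apply]; rewrite /image_set_system /= setTI.
apply: smallest_sub.
  exact/sigma_algebra_image/smallest_sigma_algebra.
move=> A oA; rewrite /image_set_system /= setTI.
by apply: sub_sigma_algebra; exact: cf.
Qed.

Definition is_borel d (X : topMeasurableType d) : Prop :=
  @measurable d X = <<s @open X >>.

(** Cylinders over Borel sets are Borel since the projections are continuous.
    Conversely an open set is the union of the basic rectangles that it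
    contains, and second countability leaves only countably many of them. *)
Lemma is_borel_prod d1 d2 (X : topMeasurableType d1)
    (Y : topMeasurableType d2) :
  @second_countable X -> @second_countable Y ->
  is_borel X -> is_borel Y -> is_borel (X * Y)%type.
Proof.
move=> [A cA [oA bA]] [B cB [oB bB]] hX hY; rewrite /is_borel eqEsubset; split.
  apply: smallest_sub; first exact: smallest_sigma_algebra.
  move=> _ [[C mC <-]|[C mC <-]]; rewrite setTI.
    apply: continuous_preimage_borel; last by rewrite -hX.
    by move=> x; exact: cvg_fst.
  apply: continuous_preimage_borel; last by rewrite -hY.
  by move=> x; exact: cvg_snd.
apply: smallest_sub; first exact: sigma_algebra_measurable.
move=> W oW.
pose D := [set P : set X * set Y | (A `*` B) P /\ P.1 `*` P.2 `<=` W].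
have cD : countable D.
  by apply: (@sub_countable _ _ _ (A `*` B));
    [apply: subset_card_le => ? []|exact: countableX].
have -> : W = \bigcup_(P in D) (P.1 `*` P.2).
  rewrite eqEsubset; split; last by apply: bigcup_sub => P [].
  move=> [x y] Wxy.
  have [[P Q] [/= /bA[U [AU Ux] UP] /bB[V [BV Vy] VQ]] PQW] : nbhs (x, y) W.
    exact: open_nbhs_nbhs.
  by exists (U, V) => //; split=> // -[u v] [/UP Pu /VQ Qv]; exact: PQW.
rewrite bigcup_set_type; apply: countable_bigcupT_measurable.
  by rewrite (eq_countable (card_setT _)).
move=> [P /=]; rewrite inE => -[[AP BP] _].
by apply: measurableX; [rewrite hX|rewrite hY];
  apply: sub_sigma_algebra; [exact: oA|exact: oB].
Qed.

(** The product measure of the preimage of [B] is the integral of the measures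
    of its sections, and the section over [x] involves only the single map
    [k x]; so each [k x] can be treated separately, whatever the dependence
    on [x]. *)
Lemma skew_preserves (R : realType) d1 d2 (X : topMeasurableType d1)
    (Y : topMeasurableType d2) (mu : probability X R) (nu : probability Y R)
    (f : X -> X) (k : X -> Y -> Y) :
  is_borel X -> is_borel Y -> is_borel (X * Y)%type ->
  continuous f -> preserves mu f -> (forall x, preserves nu (k x)) ->
  preserves (mu \x nu)%E (fun p : X * Y => (f p.1, k p.1 p.2)).
Proof.
move=> bX bY bXY cf pf pk B; rewrite -bXY => mB.
have mf : measurable_fun setT f.
  move=> _ C mC; rewrite setTI bX; apply: continuous_preimage_borel => //.
  by rewrite -bX.
rewrite /= /product_measure1.
have section_measure x :
    (nu \o xsection ((fun p : X * Y => (f p.1, k p.1 p.2)) @^-1` B)) x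
    = (nu \o xsection B) (f x).
  rewrite /= -(pk x (xsection B (f x))); last first.
    by rewrite -bY; exact: measurable_xsection.
  by congr (nu _); apply/seteqP; split=> y /=; rewrite /xsection/= !inE.
under eq_integral do rewrite section_measure.
(* change of variables: the pushforward of mu by f is mu *)
rewrite -[LHS](@ge0_integral_pushforward _ _ _ _ _ f mf mu setT
  (nu \o xsection B)) //.
  by apply: eq_measure_integral => C mC _; apply: pf; rewrite -bX.
exact: measurable_fun_xsection.
Qed.

Section GroupProducts.
Context (R : realType) (d : nat -> measure_display).
Variable G : forall j, compactMetricGroupType R (d j).

Lemma compact_metric_group_second_countable j : @second_countable (G j).
Proof. exact: compact_second_countable compact_setT. Qed.

(** The two properties are proved together because second countability of the
    base is what makes the next product sigma-algebra Borel. *)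
Lemma gprod_borel n : @second_countable (gprod G n) /\ is_borel (gprod G n).
Proof.
elim: n => [|n [s b]] /=.
  by split; [exact: compact_metric_group_second_countable
            |exact: measurable_borel].
have sG := @compact_metric_group_second_countable n.+1.
split; first exact: (second_countable_prod s sG).
by apply: is_borel_prod => //; exact: measurable_borel.
Qed.

(** Restricting to the slice over the unit of the last group and projecting
    recovers the map on the first factors. *)
Lemma gskew_continuous_base (h0 : G 0%N -> G 0%N)
    (h : forall j : nat, gprod G j -> G j.+1 -> G j.+1) m :
  continuous (@gskew R d G h0 h m.+1) -> continuous (@gskew R d G h0 h m).
Proof.
move=> cf x.
have c1 : {for x, continuous (fun x : gprod G m => (x, 1%g : G m.+1))}.
  by apply: cvg_pair; [exact: cvg_id|exact: cvg_cst].
have := continuous_comp (continuous_comp c1 (cf _)) (@cvg_fst _ _ _ _ _).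
exact.
Qed.

End GroupProducts.

Theorem theorem2p1p1 (R : realType) (n : nat) (d : nat -> measure_display)
  (G : forall j : nat, compactMetricGroupType R (d j))
  (mu : forall j : nat, probability (G j) R)
  (mu_haar : forall j : nat, (j <= n)%N -> is_haar (mu j))
  (h0 : G 0%N -> G 0%N) (h0_Homeo : Homeo (mu 0%N) h0)
  (h : forall j : nat, gprod G j -> G j.+1 -> G j.+1)
  (h_Homeo : forall j : nat, (j < n)%N ->
     forall x : gprod G j, Homeo (mu j.+1) (h j x)) :
  self_homeomorphism (@gskew R d G h0 h n) ->
  preserves (gprod_measure mu n) (@gskew R d G h0 h n).
Proof.
(* The induction runs on the continuity of the skew map, which passes to the
   base. *)
move=> [cf _]; elim: n {mu_haar} h_Homeo cf => [_ _|n IHn h_Homeo cf].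
  exact: h0_Homeo.2.
have cf' := gskew_continuous_base cf.
apply: (skew_preserves _ _ _ cf').
- exact: (gprod_borel G n).2.
- exact: measurable_borel.
- exact: (gprod_borel G n.+1).2.
- by apply: IHn => // j jn; apply: h_Homeo; rewrite ltnS ltnW.
- by move=> x; exact: (h_Homeo n (ltnSn n) x).2.
Qed.
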